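(* Let $T\in\mathcal{B}(\mathcal{H})$. Then $W_{q,A}(T)$ is convex.
   Context: $\mathcal{H}$ is a complex Hilbert space, $\mathcal{B}(\mathcal{H})$ is the algebra of bounded linear operators on $\mathcal{H}$, $A\in\mathcal{B}(\mathcal{H})$ is a positive operator ($\langle Ax,x\rangle\ge0$ for all $x$) whose range satisfies $\dim\mathcal{R}(A)\ge2$, and $q\in\mathbb{C}$ with $|q|\le1$. Put $\langle x,y\rangle_A=\langle Ax,y\rangle$, $\|x\|_A=\sqrt{\langle x,x\rangle_A}$, and $\mathbb{S}_{q,A}(\mathcal{H})=\{(x,y)\in\mathcal{H}\times\mathcal{H}:\|x\|_A=\|y\|_A=1,\ \langle x,y\rangle_A=q\}$. The $q$-$A$-numerical range of $T$ is $W_{q,A}(T)=\{\langle Tx,y\rangle_A : (x,y)\in\mathbb{S}_{q,A}(\mathcal{H})\}$. *)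

(* Defs.v *)
From HB Require Import structures.
From mathcomp Require Import all_boot all_order all_algebra complex.
From mathcomp Require Import all_classical all_reals all_analysis.

Set Implicit Arguments.
Unset Strict Implicit.
Unset Printing Implicit Defensive.

Import Order.TTheory GRing.Theory Num.Theory Num.Def.
Import numFieldNormedType.Exports.

Local Open Scope classical_set_scope.
Local Open Scope ring_scope.
Local Open Scope complex_scope.

(* The order of R[i] is the partial one for which [0 <= z] says that [z] is a
   nonnegative real; norms of vectors are values of R[i] of this kind, and
   [sqrtC] is the nonnegative square root on them. *)

Section HilbertSpace.
Variables (R : realType) (H : completeNormedModType R[i]).

(* The dot product is linear in its first argument and conjugate-linear in the
   second. Together with the completeness of [H], [hilbert_norm] makes [H] a
   complex Hilbert space. *)
Definition hilbert_norm (dot : {dot H for conjC}) : Prop :=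
  forall x : H, `|x| = sqrtC (dot x x).

Definition bounded_operator (T : {linear H -> H}) : Prop :=
  exists M : R, forall x : H, `|T x| <= M%:C * `|x|.

Lemma bounded_operatorP (T : {linear H -> H}) :
  bounded_operator T <-> bounded_near T (nbhs (0 : H)).
Proof.
rewrite linear_boundedP; split=> [[M TM]|[M [Mreal TM]]].
- exists M%:C; split=> [|r Mr x]; first by rewrite complex_real.
  by apply: (le_trans (TM x)); apply: ler_wpM2r => //; apply: ltW.
- exists (complex.Re M + 1) => x; apply: TM.
  by rewrite rmorphD rmorph1 /= RRe_real // ltrDl.
Qed.

(* [S] contains at least [n] linearly independent vectors; for a linear
   subspace [S], this is dim S >= n. *)
Definition dim_ge (n : nat) (S : set H) : Prop :=
  exists v : 'I_n -> H, (forall i, S (v i)) /\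
    forall c : 'I_n -> R[i], \sum_(i < n) c i *: v i = 0 -> forall i, c i = 0.

Variables (dot : {dot H for conjC}) (A : {linear H -> H}).

Definition positive_operator : Prop := forall x : H, 0 <= dot (A x) x.

Definition dotA (x y : H) : R[i] := dot (A x) y.

Definition normA (x : H) : R[i] := sqrtC (dotA x x).

Definition qA_sphere (q : R[i]) : set (H * H) :=
  [set xy | [/\ normA xy.1 = 1, normA xy.2 = 1 & dotA xy.1 xy.2 = q]].

Definition qA_numerical_range (q : R[i]) (T : {linear H -> H}) : set R[i] :=
  [set dotA (T xy.1) xy.2 | xy in qA_sphere q].

End HilbertSpace.

(* Main.v *)
Require Import Defs.
From HB Require Import structures.
From mathcomp Require Import all_boot all_order all_algebra complex.
From mathcomp Require Import all_classical all_reals all_analysis.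
From mathcomp Require Import ring lra.

Set Implicit Arguments.
Unset Strict Implicit.
Unset Printing Implicit Defensive.

Import Order.TTheory GRing.Theory Num.Theory Num.Def.
Import numFieldNormedType.Exports.

Local Open Scope classical_set_scope.
Local Open Scope complex_scope.
Local Open Scope ring_scope.

(** Write [a] for the semi-inner product [<x, y>_A = <A x, y>]; positivity of
    [A] makes it Hermitian, and the rank condition says that every [a]-unit
    vector has an [a]-unit vector orthogonal to it.

    If some [a]-null vector [n] has [T n] not [a]-null, then adding multiples of
    [n] to [x] does not affect the constraints on [(x, y)] but moves
    [<T x, y>_A] freely, so the numerical range is the whole plane
    ([in_range_all]). Assume from now on that there is no such [n].

    For an [a]-unit vector [x] put [z(x) = a (T x) x] and
    [h(x) = a (T x) (T x)]. The partners of [x] are the vectors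
    [y = q^* x + y'] with [y'] orthogonal to [x] and [a y' y' = 1 - |q|^2], so
    Cauchy-Schwarz puts [<T x, y>_A] in the disc [D(x)] with centre [q z(x)] and
    squared radius [(1 - |q|^2) (h(x) - |z(x)|^2)] ([pair_in_disc]). The theorem
    follows from three facts.

    - Conversely, each [D(x)] is contained in the range ([disc_sub_range]). Let
      [f] be the unit vector along [T x - z(x) x]. Inside the plane of [x] and
      [f], each unit vector [u] gives a circle of attained values, and the circle
      of [x] is the boundary of [D(x)]. The plane contains an eigenvector of the
      compression of [T], whose circle is a point. Moving [u] from [x] to that
      eigenvector shrinks the circle from one around [p] to a point, so by the
      intermediate value theorem some circle passes through [p].

    - For unit vectors [x1] and [x2] and [t] in [0, 1] some unit vector [x] has
      [z(x) = t z(x1) + (1 - t) z(x2)] and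
      [h(x) >= t h(x1) + (1 - t) h(x2)] ([chord_dominated]). Indeed [z] and [h]
      are affine in the density matrix of [x]. The matrix [diag (t, 1 - t)]
      gives the two convex combinations; a Hermitian direction [K] that keeps
      both the trace and the [z]-value exists because the matrices form a real
      space of dimension 4, and these are 3 real conditions. The line along [K]
      leaves the cone of positive matrices on both sides, at matrices of rank
      one, which come from vectors; on one of the two sides [h] has not
      decreased.

    - The squared radius is concave along such a combination
      ([disc_convex]), so the combination of a point of [D(x1)] and a point of
      [D(x2)] lies in [D(x)]. *)

(** * Scalars *)

Section Scalars.
Variable R : rcfType.
Local Notation C := R[i].

Lemma sqrtC_sq (x : C) : 0 <= x -> exists2 y : C, 0 <= y & y * y = x.
Proof. by move=> x0; exists (sqrtC x); rewrite ?sqrtC_ge0// -expr2 sqrtCK. Qed.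

Lemma conj_real_complex (x : R) : (x%:C : C)^* = x%:C.
Proof. by apply: (CrealP _); rewrite complex_real. Qed.

Lemma real_poly_normsq (P : {poly C}) :
  exists U : {poly R}, forall l : R, U.[l]%:C = P.[l%:C] * P.[l%:C]^*.
Proof.
have [U [V PE]] : exists U V : {poly R}, forall l : R,
    P.[l%:C] = U.[l] +i* V.[l].
  elim/poly_ind: P => [|P c [U [V PE]]].
    by exists 0, 0 => l; rewrite !horner0.
  exists (U * 'X + (complex.Re c)%:P), (V * 'X + (complex.Im c)%:P) => l.
  rewrite !hornerE PE; case: c => x y /=.
  by apply/eqP; rewrite eq_complex/=; apply/andP; split; apply/eqP; ring.
exists (U ^+ 2 + V ^+ 2) => l; rewrite PE !hornerE/=.
by rewrite -[RHS]normCK -add_Re2_Im2.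
Qed.

(** The squared moduli of [P] and [Q] along the real axis are real polynomials,
    to which the intermediate value theorem of a real closed field applies. *)
Lemma poly_norm_ivt (P Q : {poly C}) :
  `|P.[0]| <= `|Q.[0]| -> `|Q.[1]| <= `|P.[1]| ->
  exists l : R, `|P.[l%:C]| = `|Q.[l%:C]|.
Proof.
have [U UE] := real_poly_normsq P; have [V VE] := real_poly_normsq Q.
move=> /(lerXn2r 2 (normr_ge0 _) (normr_ge0 _)) PQ0.
move=> /(lerXn2r 2 (normr_ge0 _) (normr_ge0 _)) QP1.
have G0 : (U - V).[0] <= 0.
  rewrite !hornerE subr_le0 -lecR UE VE.
  by move: PQ0; rewrite !normCK.
have G1 : 0 <= (U - V).[1].
  rewrite !hornerE subr_ge0 -lecR UE VE.
  by move: QP1; rewrite !normCK.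
have [l _] := @Num.Theory.poly_ivt R (U - V) 0 1 ler01 (introT andP (conj G0 G1)).
rewrite /root !hornerE subr_eq0 => /eqP UV; exists l.
apply/eqP; rewrite -(@eqrXn2 _ 2)//.
by rewrite !normCK -UE -VE UV.
Qed.

(** The product of the roots is [- E / D], hence nonpositive. Having a root of
    each sign allows a move along [K] in the sense in which [h] does not
    decrease. *)
Lemma quadratic_roots (D B E : R) : 0 < D -> 0 <= E ->
  (exists2 t, 0 <= t & D * t ^+ 2 - B * t - E = 0) /\
  (exists2 t, t <= 0 & D * t ^+ 2 - B * t - E = 0).
Proof.
move=> D0 E0; pose S := Num.sqrt (B ^+ 2 + 4 * D * E).
have disc_ge0 : 0 <= B ^+ 2 + 4 * D * E.
  by rewrite addr_ge0 ?sqr_ge0// !mulr_ge0// ltW.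
have SE : S ^+ 2 = B ^+ 2 + 4 * D * E by rewrite sqr_sqrtr.
have BS : `|B| <= S.
  by rewrite -sqrtr_sqr ler_sqrt// lerDl !mulr_ge0// ltW.
have [BS1 BS2] : - S <= B /\ B <= S by apply/andP; rewrite -ler_norml.
have D2 : 2 * D != 0 by rewrite mulf_neq0 ?pnatr_eq0 ?gt_eqF.
split.
  exists ((B + S) / (2 * D)).
    by rewrite divr_ge0//; [lra|rewrite mulr_ge0 ?ltW].
  have -> : D * ((B + S) / (2 * D)) ^+ 2 - B * ((B + S) / (2 * D)) - E
     = (S ^+ 2 - B ^+ 2 - 4 * D * E) / (4 * D).
    by field; rewrite gt_eqF.
  by rewrite SE; ring.
exists ((B - S) / (2 * D)).
  by rewrite pmulr_lle0 ?invr_gt0 ?pmulr_rgt0//; lra.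
have -> : D * ((B - S) / (2 * D)) ^+ 2 - B * ((B - S) / (2 * D)) - E
   = (S ^+ 2 - B ^+ 2 - 4 * D * E) / (4 * D).
  by field; rewrite gt_eqF.
by rewrite SE; ring.
Qed.

(** Four vectors of [R * C], a real space of dimension 3. *)
Lemma real_dependency (u : 'I_4 -> R) (v : 'I_4 -> C) :
  exists k : 'I_4 -> R, [/\ exists i, k i != 0,
    \sum_i k i * u i = 0 & \sum_i (k i)%:C * v i = 0].
Proof.
pose M : 'M[R]_(4, 3) := \matrix_(i, j)
  [:: u i; complex.Re (v i); complex.Im (v i)]`_j.
have : kermx M != 0.
  by rewrite kermx_eq0 /row_free neq_ltn ltnS rank_leq_col.
case/rowV0Pn => k /sub_kermxP kM k0.
have kMj j : \sum_i k 0 i * M i j = 0.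
  by have := congr1 (fun N : 'rV_3 => N 0 j) kM; rewrite !mxE.
exists (k 0); split.
- apply/existsP; move: k0; apply: contraNT; rewrite negb_exists => /forallP k0.
  by apply/eqP/rowP => i; rewrite mxE; apply/eqP; move: (k0 i); rewrite negbK.
- rewrite -[RHS](kMj 0); apply: eq_bigr => i _.
  by rewrite mxE.
- have Re0 : \sum_i k 0 i * complex.Re (v i) = 0.
    by rewrite -[RHS](kMj 1); apply: eq_bigr => i _; rewrite mxE.
  have Im0 : \sum_i k 0 i * complex.Im (v i) = 0.
    by rewrite -[RHS](kMj (inord 2)); apply: eq_bigr => i _; rewrite mxE inordK.
  have -> : \sum_i (k 0 i)%:C * v i =
     (\sum_i k 0 i * complex.Re (v i)) +i* (\sum_i k 0 i * complex.Im (v i)).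
    rewrite !big_ord_recl !big_ord0.
    case: (v _) (v _) (v _) (v _) => [? ?] [? ?] [? ?] [? ?] /=.
    by apply/eqP; rewrite eq_complex/=; apply/andP; split; apply/eqP; ring.
  by rewrite Re0 Im0.
Qed.

(** A positive matrix of size 2 and determinant 0 is the outer product of a
    vector with itself. Here and below, [m], [w], [w^*], [n] are the entries of a
    Hermitian matrix. *)
Lemma rank_one_factor (m w n : C) : 0 <= m -> 0 <= n -> m * n = w * w^* ->
  exists al be : C, [/\ al * al^* = m, al * be^* = w & be * be^* = n].
Proof.
move=> m0 n0 mn; have [m00|mN0] := eqVneq m 0.
  have w0 : w = 0.
    by apply/eqP; rewrite -mul_conjC_eq0 -mn m00 mul0r.
  have [s s0 sE] := sqrtC_sq n0; exists 0, s.
  by rewrite m00 w0 !mul0r (CrealP (ger0_real s0)).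
have [s s0 sE] := sqrtC_sq m0.
have sN0 : s != 0 by apply: contraNneq mN0 => s00; rewrite -sE s00 mul0r.
have sR := CrealP (ger0_real s0).
exists s, (w^* / s); rewrite sR; split=> //.
  by rewrite rmorphM fmorphV/= sR conjCK mulrC divfK.
rewrite rmorphM fmorphV/= sR conjCK mulrACA -invfM sE mulrC [w^* * w]mulrC -mn.
by rewrite mulKf.
Qed.

(** The direction [K] along which the density matrix is moved: the first equation
    preserves the trace, with [c] the inner product of two unit vectors, and the
    second one preserves the value of the form with entries [dij]. *)
Lemma hermitian_dependency (c d11 d12 d21 d22 : C) :
  exists (m n : R) (w : C), [/\ [|| m != 0, n != 0 | w != 0],
    m%:C + n%:C + (w * c + (w * c)^*) = 0 &
    m%:C * d11 + w * d12 + w^* * d21 + n%:C * d22 = 0].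
Proof.
pose u : seq R := [:: 1; complex.Re c *+ 2; - complex.Im c *+ 2; 1].
pose v : seq C := [:: d11; d12 + d21; 'i * (d12 - d21); d22].
have [k [[i ki] ku kv]] := real_dependency (fun i => u`_i) (fun i => v`_i).
pose k1 := k (inord 1); pose k2 := k (inord 2).
have ord4 (F : 'I_4 -> C) :
    \sum_i F i = F ord0 + F (inord 1) + F (inord 2) + F ord_max.
  rewrite !big_ord_recl big_ord0 addr0 !addrA.
  by congr (F _ + F _ + F _ + F _); apply/val_inj; rewrite /= ?inordK.
have iC : ('i : C)^* = - 'i by rewrite conjCi.
have cE : c = (complex.Re c)%:C + 'i * (complex.Im c)%:C by rewrite [LHS]complexE.
exists (k ord0), (k ord_max), (k1%:C + 'i * k2%:C); split.
- apply: contraTT ki; rewrite !negb_or !negbK => /and3P[/eqP k00 /eqP k30 /eqP].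
  have -> : k1%:C + 'i * k2%:C = k1 +i* k2.
    by rewrite [RHS]complexE.
  move=> /(congr1 (fun x => (complex.Re x, complex.Im x)))/= [k10 k20].
  have : i \in [:: ord0; inord 1; inord 2; ord_max].
    by rewrite !inE -!val_eqE/= !inordK//; case: i => -[|[|[|[|]]]].
  by rewrite !inE => /or4P[] /eqP ->; apply/eqP.
- have := congr1 (fun x : R => x%:C : C) ku.
  rewrite rmorph_sum ord4 !rmorphM/= !inordK//= /k1 /k2 => ku'.
  rewrite !mulr1 in ku'.
  have -> : ((k (inord 1))%:C + 'i * (k (inord 2))%:C)^* =
      (k (inord 1))%:C - 'i * (k (inord 2))%:C :> C.
    by rewrite rmorphD rmorphM/= iC !conj_real_complex mulNr.
  rewrite {2}cE {1}cE rmorphD rmorphM/= iC !conj_real_complex.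
  rewrite -[RHS]ku' !rmorphMn/= rmorphN/=.
  ring: (sqrCi C).
- rewrite -[RHS]kv ord4 !inordK//= /k1 /k2 rmorphD rmorphM/= iC.
  by rewrite !conj_real_complex; ring.
Qed.

(** In a basis of two independent unit vectors with inner product [c], a
    semidefinite matrix of trace zero vanishes; so the nonzero matrix [K] has a
    negative determinant. *)
Lemma traceless_indefinite (m n : R) (c w : C) : c * c^* < 1 ->
  [|| m != 0, n != 0 | w != 0] -> m%:C + n%:C + (w * c + (w * c)^*) = 0 ->
  (m * n)%:C < w * w^*.
Proof.
move=> c1 mwn tr0; have c2 : 0 < 1 - c * c^* by rewrite subr_gt0.
rewrite real_ltNge ?complex_real ?(ger0_real (mul_conjC_ge0 w))//; apply/negP => wmn.
have semidef0 (k l : R) : k%:C + l%:C + (w * c + (w * c)^*) = 0 ->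
    w * w^* <= (k * l)%:C -> w = 0 /\ k = 0.
  move=> tr wkl.
  (* [k] times the trace, with the square of [k + w c] completed. *)
  have : (k%:C + w * c) * (k%:C + w * c)^* +
      (((k * l)%:C - w * w^*) + w * w^* * (1 - c * c^*)) = 0 :> C.
    rewrite -[RHS](mulr0 k%:C) -tr !rmorphD !rmorphM/= conj_real_complex.
    ring.
  have wc0 : 0 <= w * w^* * (1 - c * c^*).
    by rewrite mulr_ge0 ?mul_conjC_ge0// ltW.
  have det0 : 0 <= (k * l)%:C - w * w^* by rewrite subr_ge0.
  move/eqP; rewrite paddr_eq0 ?mul_conjC_ge0 ?(addr_ge0 det0)//.
  rewrite paddr_eq0// !mul_conjC_eq0 mulf_eq0 mul_conjC_eq0.
  rewrite (gt_eqF c2) orbF => /andP[/eqP kw /andP[_ /eqP w0]]; split=> //.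
  by move: kw; rewrite w0 mul0r addr0 => -[].
have [w0 m0] : w = 0 /\ m = 0 by exact: semidef0 tr0 wmn.
have [_ n0] : w = 0 /\ n = 0.
  apply: (semidef0 n m); [rewrite [n%:C + _]addrC|rewrite [n * m]mulrC] => //.
by move: mwn; rewrite w0 m0 n0 !eqxx.
Qed.

End Scalars.

(** * Semi-inner products *)

Section SemiInner.
Variables (R : rcfType) (H : lmodType R[i]).
Local Notation C := R[i].
Variable a : {hermitian_sym H for @conjC C}.
Hypothesis a_ge0 : forall x, 0 <= a x x.

Lemma form_conj x y : (a x y)^* = a y x.
Proof. by rewrite [in RHS]hermC/= expr0 mul1r. Qed.

Lemma form_real x : (a x x)^* = a x x.
Proof. exact: form_conj. Qed.

Lemma form_lincomb (al be ga de : C) e f e' f' :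
  a (al *: e + be *: f) (ga *: e' + de *: f') =
  al * ga^* * a e e' + al * de^* * a e f' + be * ga^* * a f e'
  + be * de^* * a f f'.
Proof.
rewrite (linearDl a) !(linearDr a) !(linearZl_LR a) !(linearZr_LR a) /=; ring.
Qed.

Lemma form_combl (al be : C) e f y :
  a (al *: e + be *: f) y = al * a e y + be * a f y.
Proof. by rewrite (linearDl a) !(linearZl_LR a). Qed.

Lemma form_combr (ga de : C) x e f :
  a x (ga *: e + de *: f) = ga^* * a x e + de^* * a x f.
Proof. by rewrite (linearDr a) !(linearZr_LR a). Qed.

(** Since [a] may be degenerate, both vectors can be null; in that case
    [x - a x y *: y] is the vector to test instead of [a y y *: x - a x y *: y]. *)
Lemma cauchy_schwarz x y : a x y * (a x y)^* <= a x x * a y y.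
Proof.
wlog ayy : x y / a y y != 0 => [hw|].
  have [ayy|/hw//] := eqVneq (a y y) 0.
  have [axx|/hw] := eqVneq (a x x) 0; last first.
    by move=> yx; rewrite [leRHS]mulrC [leLHS]mulrC form_conj -(form_conj y x).
  have := a_ge0 (1 *: x + (- a x y) *: y).
  rewrite form_lincomb axx ayy -(form_conj x y) rmorphN rmorph1/=.
  have -> : 1 * 1 * 0 + 1 * - (a x y)^* * a x y + - a x y * 1 * (a x y)^* +
    - a x y * - (a x y)^* * 0 = - (2 * (a x y * (a x y)^*)) :> C by ring.
  by rewrite oppr_ge0 pmulr_rle0 ?ltr0n// mul0r.
have ayy0 : 0 < a y y by rewrite lt_def ayy a_ge0.
have := a_ge0 (a y y *: x + (- a x y) *: y).
rewrite form_lincomb -(form_conj x y) rmorphN/= form_real.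
have -> : a y y * a y y * a x x + a y y * - (a x y)^* * a x y
   + - a x y * a y y * (a x y)^* + - a x y * - (a x y)^* * a y y
  = a y y * (a x x * a y y - a x y * (a x y)^*) :> C by ring.
by rewrite pmulr_rge0// subr_ge0.
Qed.

Lemma null_form n y : a n n = 0 -> a n y = 0.
Proof.
move=> nn; apply/eqP; rewrite -mul_conjC_eq0; apply/eqP.
apply: le_anti; rewrite mul_conjC_ge0 andbT.
by have := cauchy_schwarz n y; rewrite nn mul0r.
Qed.

Lemma null_formr n y : a n n = 0 -> a y n = 0.
Proof. by move=> nn; rewrite -(form_conj n y) null_form// conjC0. Qed.

Lemma normalize v : a v v != 0 ->
  exists2 r : C, 0 < r & a (r^-1 *: v) (r^-1 *: v) = 1 /\ r * r = a v v.
Proof.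
move=> vv; have [r r0 rE] := sqrtC_sq (a_ge0 v).
have rN0 : r != 0 by apply: contraNneq vv => r00; rewrite -rE r00 mul0r.
exists r; first by rewrite lt_def rN0.
split=> //; rewrite (linearZl_LR a) (linearZr_LR a)/= fmorphV/= (CrealP (ger0_real r0)) -rE.
by rewrite mulKf// mulVf.
Qed.

(** * The discs that make up the numerical range *)

Variable T : {linear H -> H}.
Variable q : C.
Hypothesis q1 : q * q^* <= 1.
Hypothesis orth_unit : forall e, a e e = 1 ->
  exists f, a f f = 1 /\ a e f = 0.

Lemma linear_lincomb (al be : C) e f :
  T (al *: e + be *: f) = al *: T e + be *: T f.
Proof. by rewrite linearP (linearZ_LR T). Qed.

Definition in_range (p : C) := exists x y,
  [/\ a x x = 1, a y y = 1, a x y = q & a (T x) y = p].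


Lemma in_range_orthonormal x f (c : C) :
  a x x = 1 -> a f f = 1 -> a x f = 0 -> c * c^* = 1 - q * q^* ->
  in_range (q * a (T x) x + c * a (T x) f).
Proof.
move=> xx ff xf cE; exists x, (q^* *: x + c^* *: f); split=> //.
- rewrite form_lincomb xx ff xf -(form_conj x f) xf conjC0 !conjCK !mulr1 !mulr0.
  by rewrite !addr0 mulrC [c^* * _]mulrC cE addrC subrK.
- by rewrite form_combr xx xf !conjCK mulr1 mulr0 addr0.
- by rewrite form_combr !conjCK.
Qed.

(** The rescaled form of the preceding lemma, which avoids dividing by a norm
    along the path of [circle_interior_in_range]. *)
Lemma in_range_orthogonal p u v (c : C) :
  a u u != 0 -> a v v = a u u -> a u v = 0 -> c * c^* = 1 - q * q^* ->
  p * a u u = q * a (T u) u + c * a (T u) v ->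
  in_range p.
Proof.
move=> uu0 vv uv cE pE; have [r r0 [ruu rE]] := normalize uu0.
have rR : (r^-1)^* = r^-1.
  by rewrite fmorphV/= (CrealP (ger0_real (ltW r0))).
have rN0 : r != 0 by rewrite gt_eqF.
have vv1 : a (r^-1 *: v) (r^-1 *: v) = 1.
  by rewrite -ruu !(linearZl_LR a) !(linearZr_LR a)/= vv.
have uv1 : a (r^-1 *: u) (r^-1 *: v) = 0.
  by rewrite (linearZl_LR a) (linearZr_LR a)/= uv !mulr0.
have := in_range_orthonormal ruu vv1 uv1 cE.
have TuZ : T (r^-1 *: u) = r^-1 *: T u by rewrite linearZ.
rewrite TuZ !(linearZl_LR a) !(linearZr_LR a)/= rR.
congr in_range; apply: (mulIf uu0); rewrite pE -rE; field.
by rewrite rN0.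
Qed.

(** Cauchy-Schwarz for [T x - z x] and [y - q^* x], both orthogonal to [x]. *)
Lemma pair_in_disc x y :
  a x x = 1 -> a y y = 1 -> a x y = q ->
  (a (T x) y - q * a (T x) x) * (a (T x) y - q * a (T x) x)^*
  <= (1 - q * q^*) * (a (T x) (T x) - a (T x) x * (a (T x) x)^*).
Proof.
move=> xx yy xy; have yx : a y x = q^* by rewrite -xy form_conj.
have := cauchy_schwarz (1 *: T x + (- a (T x) x) *: x) (1 *: y + (- q^*) *: x).
rewrite !form_lincomb xx yy xy yx -!(form_conj (T x) x) !rmorphN !rmorph1/= !conjCK.
set t := a (T x) y; set z := a (T x) x; set h := a (T x) (T x).
have -> : 1 * 1 * t + 1 * - q * z + - z * 1 * q + - z * - q * 1 = t - q * z by ring.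
rewrite !rmorphB !rmorphM/=.
by congr (_ <= _); ring.
Qed.

(** The point [p] is inside the circle of radius [s |a (T x) f|] around
    [q a (T x) x], with [s^2 = 1 - |q|^2]. It is reached in the plane of [x] and
    [f] by the deformation of that circle described at the top. *)
Lemma circle_interior_in_range p x f :
  a x x = 1 -> a f f = 1 -> a x f = 0 ->
  (p - q * a (T x) x) * (p - q * a (T x) x)^*
  <= (1 - q * q^*) * (a (T x) f * (a (T x) f)^*) ->
  in_range p.
Proof.
move=> xx ff xf; set z := a (T x) x; set r := a (T x) f => pz.
have s2_ge0 : 0 <= 1 - q * q^* by rewrite subr_ge0.
have [s s0 sE] := sqrtC_sq s2_ge0.
have sR : s^* = s := CrealP (ger0_real s0).
have fx : a f x = 0 by rewrite -form_conj xf conjC0.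
have [r0|rN0] := eqVneq r 0.
  have := @in_range_orthonormal x f s xx ff xf; rewrite -/r r0 mulr0 addr0 sR sE.
  move=> /(_ erefl); rewrite -/z; congr in_range; apply/eqP.
  rewrite eq_sym -subr_eq0 -mul_conjC_eq0; apply/eqP/le_anti.
  by rewrite mul_conjC_ge0 andbT; move: pz; rewrite r0 mul0r mulr0.
pose b := a (T f) x; pose d := a (T f) f.
(* [al0 *: x + f] is an eigenvector of the compression of [T]. *)
have [al0 al0E] : exists al0 : C, r * al0 * al0 + (d - z) * al0 - b = 0.
  pose S := sqrtC ((d - z) ^+ 2 + 4 * r * b).
  have SE : S ^+ 2 = (d - z) ^+ 2 + 4 * r * b by rewrite sqrtCK.
  exists ((z - d + S) / (2 * r)).
  have -> : r * ((z - d + S) / (2 * r)) * ((z - d + S) / (2 * r)) +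
    (d - z) * ((z - d + S) / (2 * r)) - b =
    (S ^+ 2 - (d - z) ^+ 2 - 4 * r * b) / (4 * r) by field.
  by rewrite SE; ring.
(* The path [u] from [x] to the eigenvector. The vector [v l] is orthogonal to
   [u l] with the same norm; [al'] stands for the conjugate of [al] at real [l],
   as a polynomial in [l]. *)
pose al (l : C) := 1 - l + l * al0; pose al' (l : C) := 1 - l + l * al0^*.
pose u l := al l *: x + l *: f; pose v l := (- l) *: x + al' l *: f.
have alC (l : R) : (al l%:C)^* = al' l%:C.
  by rewrite /al /al' !rmorphD !rmorphN rmorphM/= rmorph1 conj_real_complex.
have al'C (l : R) : (al' l%:C)^* = al l%:C by rewrite -alC conjCK.
have lC := @conj_real_complex R.
pose N l := al l * al' l + l * l.
pose Z l := al' l * (z * al l + b * l) + l * (r * al l + d * l).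
pose Q l := - l * (z * al l + b * l) + al l * (r * al l + d * l).
have uuE (l : R) : a (u l%:C) (u l%:C) = N l%:C.
  by rewrite form_lincomb xx ff xf fx alC lC /N; ring.
have vvE (l : R) : a (v l%:C) (v l%:C) = N l%:C.
  by rewrite form_lincomb xx ff xf fx al'C rmorphN/= lC /N; ring.
have uvE (l : R) : a (u l%:C) (v l%:C) = 0.
  by rewrite form_lincomb xx ff xf fx al'C rmorphN/= lC; ring.
have TuE l : T (u l) = al l *: T x + l *: T f.
  exact: linear_lincomb.
have ZE (l : R) : a (T (u l%:C)) (u l%:C) = Z l%:C.
  by rewrite TuE form_lincomb -/z -/r -/b -/d alC lC /Z; ring.
have QE (l : R) : a (T (u l%:C)) (v l%:C) = Q l%:C.
  by rewrite TuE form_lincomb -/z -/r -/b -/d al'C rmorphN/= lC /Q; ring.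
have uu0 (l : R) : a (u l%:C) (u l%:C) != 0.
  have -> : a (u l%:C) (u l%:C) = al l%:C * (al l%:C)^* + l%:C * (l%:C)^*.
    by rewrite uuE alC lC.
  apply/eqP => /eqP; rewrite paddr_eq0 ?mul_conjC_ge0// !mul_conjC_eq0.
  move=> /andP[+ /eqP l0]; rewrite /al l0 mul0r subr0 addr0.
  by rewrite oner_eq0.
pose alP : {poly C} := 1 - 'X + 'X * al0%:P.
pose alP' : {poly C} := 1 - 'X + 'X * (al0^*)%:P.
pose PP : {poly C} := p%:P * (alP * alP' + 'X * 'X)
  - q%:P * (alP' * (z%:P * alP + b%:P * 'X) + 'X * (r%:P * alP + d%:P * 'X)).
pose QP : {poly C} :=
  s%:P * (- 'X * (z%:P * alP + b%:P * 'X) + alP * (r%:P * alP + d%:P * 'X)).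
have PPE l : PP.[l] = p * N l - q * Z l by rewrite !hornerE.
have QPE l : QP.[l] = s * Q l by rewrite !hornerE.
(* [Q 1 = 0] because [u 1] is an eigenvector. *)
have [||l PQ] := @poly_norm_ivt R PP QP.
- have -> : PP.[0] = p - q * z by rewrite PPE /N /Z /al /al'; ring.
  have -> : QP.[0] = s * r by rewrite QPE /Q /al; ring.
  rewrite -(@ler_pXn2r _ 2)// ?nnegrE// !normCK; apply: (le_trans pz).
  by rewrite rmorphM/= sR -sE le_eqVlt; apply/orP; left; apply/eqP; ring.
- rewrite QPE.
  have -> : Q 1 = 0 by rewrite -[RHS]al0E /Q /al; ring.
  by rewrite mulr0 normr0.
rewrite PPE QPE in PQ.
have [c cE pc] : exists2 c : C, c * c^* = 1 - q * q^* &
    p * N l%:C = q * Z l%:C + c * Q l%:C.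
  have [Q0|Q0] := eqVneq (Q l%:C) 0.
    exists s; first by rewrite sR.
    apply/eqP; rewrite Q0 mulr0 addr0 -subr_eq0 -normr_eq0 PQ Q0.
    by rewrite mulr0 normr0.
  exists ((p * N l%:C - q * Z l%:C) / Q l%:C); last by rewrite divfK// addrC subrK.
  rewrite -normCK normrM normfV PQ normrM mulfK ?normr_eq0//.
  by rewrite ger0_norm// expr2.
apply: (@in_range_orthogonal p (u l%:C) (v l%:C) c) => //.
- by rewrite vvE uuE.
- by rewrite uuE ZE QE.
Qed.

Lemma orthogonal_to_image x : a x x = 1 ->
  exists f, [/\ a f f = 1, a x f = 0 &
    a (T x) f * (a (T x) f)^* = a (T x) (T x) - a (T x) x * (a (T x) x)^*].
Proof.
move=> xx; set z := a (T x) x; set h := a (T x) (T x).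
pose g := 1 *: T x + (- z) *: x.
have xTx : a x (T x) = z^* by rewrite -form_conj.
have gx : a g x = 0 by rewrite form_combl xx -/z; ring.
have xg : a x g = 0 by rewrite -form_conj gx conjC0.
have gg : a g g = h - z * z^*.
  by rewrite form_lincomb -/h -/z xTx xx rmorphN rmorph1/=; ring.
have Tg : a (T x) g = h - z * z^*.
  by rewrite form_combr -/h -/z rmorphN rmorph1/=; ring.
rewrite -gg in Tg *; have [gg0|gg0] := eqVneq (a g g) 0.
  have [f [ff xf]] := orth_unit xx; exists f; split=> //.
  have := null_form f gg0; rewrite form_combl xf mulr0 addr0 mul1r => ->.
  by rewrite mul0r gg0.
have [r r0 [ff rE]] := normalize gg0.
have rR : r^* = r := CrealP (ger0_real (ltW r0)).
exists (r^-1 *: g); split=> //; rewrite (linearZr_LR a)/=.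
  by rewrite xg mulr0.
by rewrite Tg fmorphV/= rR -rE mulKf ?gt_eqF// rR.
Qed.

Lemma disc_sub_range p x : a x x = 1 ->
  (p - q * a (T x) x) * (p - q * a (T x) x)^*
  <= (1 - q * q^*) * (a (T x) (T x) - a (T x) x * (a (T x) x)^*) ->
  in_range p.
Proof.
move=> xx; have [f [ff xf <-]] := orthogonal_to_image xx.
exact: circle_interior_in_range.
Qed.

(** * Moving the density matrix *)

(** Entries of equal sign are forced by the determinant; both negative would make
    the trace the opposite of a squared norm. *)
Lemma positive_rank_one (m n : R) (w : C) x1 x2 :
  a x1 x1 = 1 -> a x2 x2 = 1 -> (m * n)%:C = w * w^* ->
  m%:C + n%:C + (w * a x1 x2 + (w * a x1 x2)^*) = 1 -> 0 <= m /\ 0 <= n.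
Proof.
move=> x11 x22 mn tr1.
have [m0|m0|m0] := ltrgtP m 0.
- have n0 : n <= 0.
    by rewrite -(nmulr_rge0 _ m0) -lecR mn mul_conjC_ge0.
  have [|||al [be [alE be1 beE]]] := @rank_one_factor R (- m)%:C (- w) (- n)%:C.
  + by rewrite lecR oppr_ge0 ltW.
  + by rewrite lecR oppr_ge0.
  + by rewrite -rmorphM/= mulrNN mn rmorphN mulrNN.
  have := a_ge0 (al *: x1 + be *: x2).
  have be2 : be * al^* = - w^* by rewrite -[be]conjCK -rmorphM/= mulrC be1 rmorphN.
  rewrite form_lincomb alE beE be1 be2 x11 x22 -(form_conj x1 x2).
  have -> : (- m)%:C * 1 + - w * a x1 x2 + - w^* * (a x1 x2)^* + (- n)%:C * 1
     = - (m%:C + n%:C + (w * a x1 x2 + (w * a x1 x2)^*)) :> C.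
    rewrite !rmorphN rmorphM/=; ring.
  by rewrite tr1 oppr_ge0 ler10.
- by split=> //; rewrite -(pmulr_rge0 _ m0) -lecR mn mul_conjC_ge0.
- split=> //.
  have w0 : w = 0 by apply/eqP; rewrite -mul_conjC_eq0 -mn m0 mul0r.
  move: tr1; rewrite m0 w0 !mul0r conjC0 !addr0 add0r => -[->].
  exact: ler01.
Qed.

Lemma rank_one_vector (m n : R) (w : C) x1 x2 :
  a x1 x1 = 1 -> a x2 x2 = 1 -> (m * n)%:C = w * w^* ->
  m%:C + n%:C + (w * a x1 x2 + (w * a x1 x2)^*) = 1 ->
  exists x, [/\ a x x = 1,
    a (T x) x = m%:C * a (T x1) x1 + w * a (T x1) x2 + w^* * a (T x2) x1
       + n%:C * a (T x2) x2 &
    a (T x) (T x) = m%:C * a (T x1) (T x1) + w * a (T x1) (T x2)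
       + w^* * a (T x2) (T x1) + n%:C * a (T x2) (T x2)].
Proof.
move=> x11 x22 mn tr1; have [m0 n0] := positive_rank_one x11 x22 mn tr1.
have [|||al [be [alE be1 beE]]] := @rank_one_factor R m%:C w n%:C.
- by rewrite lecR.
- by rewrite lecR.
- by rewrite -rmorphM.
have be2 : be * al^* = w^* by rewrite -[be]conjCK -rmorphM/= mulrC be1.
exists (al *: x1 + be *: x2).
rewrite linear_lincomb !form_lincomb alE beE be1 be2; split=> //.
rewrite x11 x22 -(form_conj x1 x2) -[RHS]tr1 rmorphM/=; ring.
Qed.

(** The chord argument for independent [x1] and [x2]: [s] is a root of
    [det (diag (t, 1 - t) + s K) = 0], whose leading coefficient [det K] is
    negative. *)
Lemma chord_dominated_indep (t : R) x1 x2 :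
  0 <= t <= 1 -> a x1 x1 = 1 -> a x2 x2 = 1 ->
  a x1 x2 * (a x1 x2)^* < 1 ->
  exists x, [/\ a x x = 1,
    a (T x) x = t%:C * a (T x1) x1 + (1 - t)%:C * a (T x2) x2 &
    t%:C * a (T x1) (T x1) + (1 - t)%:C * a (T x2) (T x2) <= a (T x) (T x)].
Proof.
move=> /andP[t0 t1] x11 x22 x12.
have [m [n [w [mnw trK TK]]]] := hermitian_dependency (a x1 x2)
  (a (T x1) x1) (a (T x1) x2) (a (T x2) x1) (a (T x2) x2).
have indef := traceless_indefinite x12 mnw trK.
pose W : R := complex.Re w ^+ 2 + complex.Im w ^+ 2.
have WE : W%:C = w * w^* by rewrite -normCK -add_Re2_Im2.
have D0 : 0 < W - m * n by rewrite subr_gt0 -ltcR WE.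
have E0 : 0 <= t * (1 - t) by rewrite mulr_ge0// subr_ge0.
pose h := m%:C * a (T x1) (T x1) + w * a (T x1) (T x2)
       + w^* * a (T x2) (T x1) + n%:C * a (T x2) (T x2).
have hR : h \is Num.real.
  apply/CrealP; rewrite /h !rmorphD !rmorphM/= !conj_real_complex conjCK.
  rewrite !form_conj; ring.
have [s sh sE] : exists2 s : R, 0 <= s%:C * h &
    (W - m * n) * s ^+ 2 - (m * (1 - t) + n * t) * s - t * (1 - t) = 0.
  have [[s s0 sE] [s' s'0 s'E]] := quadratic_roots (m * (1 - t) + n * t) D0 E0.
  have /orP[h0|h0] := hR; [exists s => //|exists s' => //].
    by rewrite mulr_ge0// lecR.
  by rewrite mulr_le0// lecR.
pose m' := t + s * m; pose n' := 1 - t + s * n; pose w' := s%:C * w.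
have mn' : (m' * n')%:C = w' * w'^*.
  have -> : w' * w'^* = s%:C * s%:C * (w * w^*) :> C.
    by rewrite /w' rmorphM/= conj_real_complex; ring.
  rewrite -WE -!rmorphM/=; congr (_%:C).
  by apply/eqP; rewrite eq_sym -subr_eq0 -[X in _ == X]sE /m' /n'; apply/eqP; ring.
have tr' : m'%:C + n'%:C + (w' * a x1 x2 + (w' * a x1 x2)^*) = 1.
  rewrite /m' /n' /w' -[RHS]addr0 -[X in _ = _ + X](mulr0 s%:C) -trK.
  rewrite !rmorphD rmorphN !rmorphM/= rmorph1 conj_real_complex; ring.
have [x [xx Txx TxTx]] := rank_one_vector x11 x22 mn' tr'.
exists x; split=> //.
  rewrite Txx -[RHS]addr0 -[X in _ = _ + X](mulr0 s%:C) -TK.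
  rewrite /m' /n' /w' !rmorphD rmorphN !rmorphM/= rmorph1 conj_real_complex.
  ring.
rewrite -subr_ge0; suff -> : a (T x) (T x) -
  (t%:C * a (T x1) (T x1) + (1 - t)%:C * a (T x2) (T x2)) = s%:C * h by [].
rewrite TxTx /h /m' /n' /w' !rmorphD rmorphN !rmorphM/= rmorph1.
rewrite conj_real_complex; ring.
Qed.

(** Along a segment, the squared modulus falls short of its affine interpolation
    by [t (1 - t) |x - y|^2]. The loss has the favourable sign both for the
    displacements [d] and for the centres [z]. *)
Lemma disc_convex (t z1 z2 h1 h2 d1 d2 s : C) :
  0 <= t -> 0 <= 1 - t -> 0 <= s ->
  d1 * d1^* <= s * (h1 - z1 * z1^*) -> d2 * d2^* <= s * (h2 - z2 * z2^*) ->
  (t * d1 + (1 - t) * d2) * (t * d1 + (1 - t) * d2)^* <=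
  s * (t * h1 + (1 - t) * h2
       - (t * z1 + (1 - t) * z2) * (t * z1 + (1 - t) * z2)^*).
Proof.
move=> t0 t1 s0 dh1 dh2.
have tR : t^* = t := CrealP (ger0_real t0).
have cE (x y : C) : (t * x + (1 - t) * y) * (t * x + (1 - t) * y)^* =
   t * (x * x^*) + (1 - t) * (y * y^*) - t * (1 - t) * ((x - y) * (x - y)^*).
  by rewrite !(rmorphD, rmorphN, rmorphM, rmorph1)/= tR; ring.
rewrite !cE.
apply: (@le_trans _ _ (t * (d1 * d1^*) + (1 - t) * (d2 * d2^*))).
  by rewrite gerBl (mulr_ge0 (mulr_ge0 t0 t1) (mul_conjC_ge0 _)).
apply: (@le_trans _ _ (t * (s * (h1 - z1 * z1^*)) + (1 - t) * (s * (h2 - z2 * z2^*)))).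
  by rewrite lerD// ler_wpM2l.
rewrite -subr_ge0.
have -> : s * (t * h1 + (1 - t) * h2 - (t * (z1 * z1^*) + (1 - t) * (z2 * z2^*)
    - t * (1 - t) * ((z1 - z2) * (z1 - z2)^*))) -
   (t * (s * (h1 - z1 * z1^*)) + (1 - t) * (s * (h2 - z2 * z2^*))) =
   s * (t * (1 - t) * ((z1 - z2) * (z1 - z2)^*)) :> C by ring.
exact: mulr_ge0 s0 (mulr_ge0 (mulr_ge0 t0 t1) (mul_conjC_ge0 _)).
Qed.

(** * Convexity for a semi-inner product *)

Lemma in_range_all n : a n n = 0 -> a (T n) (T n) != 0 -> forall p, in_range p.
Proof.
move=> nn Tn p; have [r r0 [yy rE]] := normalize Tn.
set y := r^-1 *: T n in yy.
have [f [ff yf]] := orth_unit yy.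
have [s s0 sE] := sqrtC_sq (etrans (subr_ge0 _ _) q1).
have Tny : a (T n) y = r.
  rewrite (linearZr_LR a)/= -rE fmorphV/= (CrealP (ger0_real (ltW r0))).
  by rewrite mulKf// gt_eqF.
pose x := q *: y + s *: f.
have fy : a f y = 0 by rewrite -form_conj yf conjC0.
have xx : a x x = 1.
  rewrite form_lincomb yy ff yf fy (CrealP (ger0_real s0)) sE; ring.
pose c := (p - a (T x) y) / r.
exists (1 *: x + c *: n), y; split=> //.
- rewrite form_lincomb xx nn (null_form _ nn) (null_formr _ nn) rmorph1; ring.
- by rewrite form_combl (null_form _ nn) mulr0 addr0 mul1r form_combl yy fy; ring.
- by rewrite linear_lincomb form_combl Tny /c divfK ?gt_eqF//; ring.
Qed.

Section NullPreserving.

Hypothesis T_null : forall n, a n n = 0 -> a (T n) (T n) = 0.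

(** If [x1] and [x2] are dependent modulo null vectors, then [z] and [h] agree on
    them, as [T] preserves null vectors. *)
Lemma chord_dominated (t : R) x1 x2 :
  0 <= t <= 1 -> a x1 x1 = 1 -> a x2 x2 = 1 ->
  exists x, [/\ a x x = 1,
    a (T x) x = t%:C * a (T x1) x1 + (1 - t)%:C * a (T x2) x2 &
    t%:C * a (T x1) (T x1) + (1 - t)%:C * a (T x2) (T x2) <= a (T x) (T x)].
Proof.
move=> t01 x11 x22.
have := cauchy_schwarz x1 x2; rewrite x11 x22 mulr1 le_eqVlt => /orP[/eqP x12|]; last first.
  exact: chord_dominated_indep.
set c := a x1 x2 in x12.
pose n := 1 *: x2 + (- c^*) *: x1.
have nn : a n n = 0.
  rewrite form_lincomb x11 x22 -(form_conj x1 x2) -/c rmorphN rmorph1/= conjCK.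
  by rewrite -[RHS](subrr 1) -[in X in _ = _ - X]x12; ring.
have Tnn := T_null nn.
have x2E : x2 = c^* *: x1 + 1 *: n.
  by rewrite /n !scale1r scaleNr addrCA subrr addr0.
have h2 : a (T x2) (T x2) = a (T x1) (T x1).
  rewrite x2E linear_lincomb form_lincomb (null_form _ Tnn) (null_formr _ Tnn) Tnn.
  by rewrite conjCK !mulr0 !addr0 [c^* * _]mulrC x12 mul1r.
have z2 : a (T x2) x2 = a (T x1) x1.
  rewrite {1}x2E linear_lincomb x2E form_lincomb (null_form _ Tnn) (null_form _ Tnn).
  rewrite (null_formr _ nn) conjCK.
  by rewrite !mulr0 !addr0 [c^* * _]mulrC x12 mul1r.
exists x1; split=> //; first by rewrite z2 rmorphB rmorph1/=; ring.
rewrite h2 rmorphB rmorph1/= le_eqVlt; apply/orP; left; apply/eqP; ring.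
Qed.

Lemma in_range_convex_null (t : R) p1 p2 : 0 <= t <= 1 ->
  in_range p1 -> in_range p2 -> in_range (t%:C * p1 + (1 - t)%:C * p2).
Proof.
move=> t01 [x1 [y1 [x11 y11 xy1 p1E]]] [x2 [y2 [x22 y22 xy2 p2E]]].
have s0 : 0 <= 1 - q * q^* by rewrite subr_ge0.
have d1 := pair_in_disc x11 y11 xy1; have d2 := pair_in_disc x22 y22 xy2.
rewrite p1E in d1; rewrite p2E in d2.
have tC : (1 - t)%:C = 1 - t%:C :> C by rewrite rmorphB rmorph1.
have [x [xx Txx TxTx]] := chord_dominated t01 x11 x22.
have /andP[t0 t1] := t01.
have t0C : 0 <= t%:C :> C by rewrite lecR.
have t1C : 0 <= 1 - t%:C :> C by rewrite -tC lecR subr_ge0.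
apply: (disc_sub_range xx); rewrite Txx.
have := disc_convex t0C t1C s0 d1 d2; rewrite !tC in TxTx * => /= dd.
set d := (X in X * X^* <= _).
have -> : d = t%:C * (p1 - q * a (T x1) x1) + (1 - t%:C) * (p2 - q * a (T x2) x2).
  by rewrite /d; ring.
by apply: (le_trans dd); rewrite ler_wpM2l// lerB.
Qed.

End NullPreserving.

Lemma in_range_convex (t : R) p1 p2 : 0 <= t <= 1 ->
  in_range p1 -> in_range p2 -> in_range (t%:C * p1 + (1 - t)%:C * p2).
Proof.
have [[n [nn Tn]]|null] := pselect (exists n, a n n = 0 /\ a (T n) (T n) != 0).
  by move=> *; exact: in_range_all nn Tn _.
apply: in_range_convex_null => n nn; apply: contra_notP null => /eqP Tn.
by exists n.
Qed.

End SemiInner.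

(** * The semi-inner product of a positive operator *)

Section Operator.
Variables (R : realType) (H : completeNormedModType R[i]).
Variables (dot : {dot H for @conjC R[i]}) (A : {linear H -> H}).
Hypothesis A_ge0 : positive_operator dot A.

Lemma dotA_lincombl c x y z :
  dotA dot A (c *: x + y) z = c * dotA dot A x z + dotA dot A y z.
Proof. by rewrite /dotA linearP linearPl. Qed.

Lemma dotA_lincombr c x y z :
  dotA dot A x (c *: y + z) = c^* * dotA dot A x y + dotA dot A x z.
Proof. by rewrite /dotA linearPr. Qed.

(** Polarization: [<A u, u>] is real at [c x + y] for [c = 1] and [c = 'i]. *)
Lemma dotA_conj x y : dotA dot A x y = (dotA dot A y x)^*.
Proof.
have real z : (dotA dot A z z)^* = dotA dot A z z.
  by apply/CrealP/ger0_real/A_ge0.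
have b_real c : c * dotA dot A x y + c^* * dotA dot A y x =
    c^* * (dotA dot A x y)^* + c * (dotA dot A y x)^*.
  have := real (c *: x + y); rewrite !(dotA_lincombl, dotA_lincombr).
  rewrite !rmorphD !rmorphM/= !rmorphD !rmorphM/= conjCK !real => rE.
  apply/eqP; rewrite -subr_eq0; move/eqP: rE; rewrite eq_sym -subr_eq0 => /eqP <-.
  by apply/eqP; ring.
have b1 := b_real 1; have bi := b_real 'i.
rewrite conjCi in bi; rewrite conjC1 !mul1r in b1.
apply: (mulfI (_ : 2 != 0 :> R[i])); first by rewrite pnatr_eq0.
apply: (mulfI (neq0Ci R[i])).
have -> : 'i * (2 * dotA dot A x y) =
  'i * (dotA dot A x y + dotA dot A y x) +
  ('i * dotA dot A x y + - 'i * dotA dot A y x) :> R[i] by ring.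
by rewrite b1 bi; ring.
Qed.

Lemma dotA_hermitian :
  exists a : {hermitian_sym H for @conjC R[i]}, forall x y, a x y = dotA dot A x y.
Proof.
pose f : H -> H -> R[i] := dotA dot A.
have fl u' : GRing.linear_for *%R (f ^~ u').
  by move=> c x y; exact: dotA_lincombl.
have fr u : GRing.linear_for (conjC \; *%R) (f u).
  by move=> c x y; exact: dotA_lincombr.
have fh x y : f x y = (-1) ^+ false * (f y x)^*.
  by rewrite expr0 mul1r; exact: dotA_conj.
pose fB := bilinear_isBilinear.Build _ _ _ _ _ _ f (fl, fr).
pose fH := isHermitianSesquilinear.Build _ _ false (@conjC R[i]) f fh.
pose a : {hermitian_sym H for @conjC R[i]} := HB.pack f fB fH.
by exists a.
Qed.

Lemma dotA_null n : dotA dot A n n = 0 -> A n = 0.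
Proof.
move=> nn; have [a aE] := dotA_hermitian.
have a_ge0 x : 0 <= a x x by rewrite aE; exact: A_ge0.
apply/eqP; rewrite -(dnorm_eq0 dot); apply/eqP.
by rewrite -[LHS]/(dotA dot A n (A n)) -aE (null_form a_ge0)// aE.
Qed.

(** If projecting [H] orthogonally to [e] left only null vectors, the range of [A]
    would be the line spanned by [A e]. *)
Lemma dotA_orth_unit : dim_ge 2 (range A) ->
  forall e, dotA dot A e e = 1 ->
  exists f, dotA dot A f f = 1 /\ dotA dot A e f = 0.
Proof.
move=> [v [vA vfree]] e ee; have [a aE] := dotA_hermitian.
have a_ge0 x : 0 <= a x x by rewrite aE; exact: A_ge0.
have {}ee : a e e = 1 by rewrite aE.
pose proj w := 1 *: w + (- a w e) *: e.
have e_proj w : a e (proj w) = 0.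
  rewrite form_combr ee rmorph1 rmorphN/= form_conj; ring.
have [[w ww]|allnull] := pselect (exists w, a (proj w) (proj w) != 0).
  have [r _ [ff _]] := normalize a_ge0 ww.
  exists (r^-1 *: proj w); rewrite -!aE; split=> //.
  by rewrite (linearZr_LR a)/= e_proj mulr0.
have AE w : A w = a w e *: A e.
  have : A (proj w) = 0.
    apply: dotA_null; rewrite -aE; apply/eqP.
    by apply: contra_notT allnull => ww; exists w.
  by rewrite linear_lincomb scale1r scaleNr => /subr0_eq.
have vE i : exists c, v i = c *: A e.
  by have [w _ <-] := vA i; exists (a w e); exact: AE.
have [c0 v0] := vE ord0; have [c1 v1] := vE ord_max.
have dep b0 b1 : b0 * c0 + b1 * c1 = 0 -> b0 = 0 /\ b1 = 0.
  move=> b0E; pose b (i : 'I_2) := if i == ord0 then b0 else b1.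
  have b_eq0 : \sum_(i < 2) b i *: v i = 0.
    rewrite big_ord_recl big_ord1 /b eqxx [lift _ _](_ : _ = ord_max); last first.
      exact/val_inj.
    by rewrite v0 v1 !scalerA -scalerDl b0E scale0r.
  by have b0i := vfree b b_eq0; split; [exact: (b0i ord0)|exact: (b0i ord_max)].
have [c1_0 /eqP] : c1 = 0 /\ - c0 = 0 by apply: dep; ring.
rewrite oppr_eq0 => /eqP c0_0.
have [/eqP] : (1 : R[i]) = 0 /\ (1 : R[i]) = 0.
  by apply: dep; rewrite c0_0 c1_0; ring.
by rewrite oner_eq0.
Qed.

End Operator.

(** * The theorem *)

(* Rcomplex R is R[i] viewed as a real vector space. *)
Theorem theorem23 (R : realType) (H : completeNormedModType R[i])
    (dot : {dot H for conjC}) (A : {linear H -> H}) (q : R[i])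
    (T : {linear H -> H}) :
  hilbert_norm dot ->
  bounded_operator A -> positive_operator dot A -> dim_ge 2 (range A) ->
  `|q| <= 1 ->
  bounded_operator T ->
  @convex_set R (Rcomplex R) (qA_numerical_range dot A q T).
Proof.
move=> _ _ A_ge0 A2 q1 _.
have [a aE] := dotA_hermitian A_ge0.
have a_ge0 x : 0 <= a x x by rewrite aE; exact: A_ge0.
have qq : q * q^* <= 1 by rewrite -normCK expr_le1.
have orth e : a e e = 1 -> exists f, a f f = 1 /\ a e f = 0.
  by rewrite aE => /(dotA_orth_unit A_ge0 A2)[f]; rewrite -!aE; exists f.
have rangeE p : qA_numerical_range dot A q T p <-> in_range a T q p.
  split=> [[[x y] [/= xx yy xy] <-]|[x [y [xx yy xy <-]]]].
    exists x, y; rewrite !aE; split=> //.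
      by rewrite -[LHS]sqrtCK [sqrtC _]xx expr1n.
    by rewrite -[LHS]sqrtCK [sqrtC _]yy expr1n.
  exists (x, y); last by rewrite aE.
  by split; rewrite /= /normA -?aE ?xx ?yy ?sqrtC1.
move=> p1 p2 t /set_mem/rangeE p1W /set_mem/rangeE p2W; apply/mem_set/rangeE.
have t01 : 0 <= t%:num <= 1 by apply/andP.
have scaleE (k : R) (x : Rcomplex R) : k%:C * x = k *: x.
  by case: x => u v; apply/eqP; rewrite eq_complex/= !mul0r subr0 addr0 !eqxx.
have := in_range_convex a_ge0 qq orth t01 p1W p2W.
by rewrite !scaleE.
Qed.
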